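(* Let $\mathcal{T}$ be a triangulated category of finite type over a field, let $\Lambda$ be a finitely generated free abelian group with a surjective group homomorphism $v:K(\mathcal{T})\to\Lambda$, and assume that there is a group homomorphism $\alpha:\mathrm{Aut}(\mathcal{T})\to\mathrm{Aut}_{\mathbb{Z}}(\Lambda)$ with $v\circ K(F)=\alpha(F)\circ v$ for all $F\in\mathrm{Aut}(\mathcal{T})$. Assume that the space $\mathrm{Stab}_\Lambda(\mathcal{T})$ of stability conditions is nonempty, and let $\mathrm{Stab}_\Lambda^\dagger(\mathcal{T})$ be a connected component of it, with Bridgeland's metric $d_B$. Then: (i) the metric space $(\mathrm{Stab}_\Lambda^\dagger(\mathcal{T}),d_B)$ is not CAT(0); (ii) the metric space $(\mathrm{Stab}_\Lambda^\dagger(\mathcal{T}),d_B)$ is not hyperbolic (in the sense of Gromov).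
   Context: $\mathcal{T}$ is of finite type over a field $k$: it is $k$-linear and $\bigoplus_i\mathrm{Hom}(E,F[i])$ is finite dimensional for all objects $E,F$. $K(\mathcal{T})$ is the Grothendieck group, $\mathrm{Aut}(\mathcal{T})$ is the group of autoequivalences of $\mathcal{T}$, and $K(F)$ is the automorphism of $K(\mathcal{T})$ induced by $F\in\mathrm{Aut}(\mathcal{T})$. Fix a norm $\|\cdot\|$ on $\Lambda\otimes_{\mathbb{Z}}\mathbb{R}$. Stability condition: a pair $\sigma=(Z,\mathcal{P})$ of a group homomorphism $Z:\Lambda\to\mathbb{C}$ and a family $\mathcal{P}=\{\mathcal{P}(\phi)\}_{\phi\in\mathbb{R}}$ of full additive subcategories of $\mathcal{T}$ such that: (1) for $0\ne E\in\mathcal{P}(\phi)$, $Z(v(E))=m(E)e^{i\pi\phi}$ with $m(E)>0$; (2) $\mathcal{P}(\phi+1)=\mathcal{P}(\phi)[1]$; (3) $\mathrm{Hom}(E_1,E_2)=0$ for $E_i\in\mathcal{P}(\phi_i)$, $\phi_1>\phi_2$; (4) every $E\neq0$ has a Harder--Narasimhan filtration, i.e. exact triangles $E_{i-1}\to E_i\to A_i\to E_{i-1}[1]$, $i=1,\dots,p$, with $E_0=0$, $E_p=E$, $0\ne A_i\in\mathcal{P}(\phi_i)$, $\phi_1>\dots>\phi_p$; (5) (support property) there is $C>0$ with $\|v(E)\|<C|Z(v(E))|$ for all $0\ne E\in\mathcal{P}(\phi)$ and all $\phi$. For $E\neq 0$ set $\phi^+_\sigma(E)=\phi_1$, $\phi^-_\sigma(E)=\phi_p$,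 $m_\sigma(E)=\sum_i|Z(v(A_i))|$. $\mathrm{Stab}_\Lambda(\mathcal{T})$ is the set of stability conditions, topologized by the generalized metric $$d_B(\sigma,\tau)=\sup_{E\neq0}\Big\{|\phi^+_\sigma(E)-\phi^+_\tau(E)|,\ |\phi^-_\sigma(E)-\phi^-_\tau(E)|,\ \Big|\log\tfrac{m_\sigma(E)}{m_\tau(E)}\Big|\Big\}\in[0,\infty],$$ which is finite on each connected component. Metric geometry. A geodesic from $x$ to $y$ is a continuous $\gamma:[0,1]\to X$ with $\gamma(0)=x,\gamma(1)=y$ and $d(\gamma(t),\gamma(t'))=d(x,y)|t-t'|$. A space is geodesic if any two distinct points are joined by a geodesic. A geodesic triangle is a union of three geodesics $[x,y],[y,z],[z,x]$. CAT(0): geodesic, and for every geodesic triangle with comparison triangle in the Euclidean plane (same side lengths), distances between points of the triangle are at most the distances between the corresponding comparison points. Hyperbolic: there is $\delta>0$ such that the space is geodesic and in every geodesic triangle each side is contained in the $\delta$-neighbourhood of the union of the other two sides.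
   Formalization: The triangulated category T is assumed to be nonzero (it has a nonzero object); for T = 0 the space of stability conditions is a single point, which is both CAT(0) and hyperbolic, so the claim fails there. *)

(* Defs.v *)
From HB Require Import structures.
From mathcomp Require Import all_boot all_order all_algebra.
From mathcomp Require Import complex.
From mathcomp.multinomials Require Import freeg.
From mathcomp Require Import all_classical all_reals all_analysis.
Import Order.TTheory GRing.Theory Num.Theory.
Import numFieldNormedType.Exports.

Set Implicit Arguments.
Unset Strict Implicit.
Unset Printing Implicit Defensive.

Local Open Scope classical_set_scope.
Local Open Scope ring_scope.
Local Open Scope quotient_scope.

Reserved Notation "g \oc f" (at level 40, left associativity).

Record linCat (k : fieldType) := LinCat {
  ob :> Type;
  hom : ob -> ob -> lmodType k;
  idm : forall A, hom A A;
  comp : forall A B C, hom B C -> hom A B -> hom A C;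
  compA : forall A B C D (h : hom C D) (g : hom B C) (f : hom A B),
    comp h (comp g f) = comp (comp h g) f;
  comp1m : forall A B (f : hom A B), comp (idm B) f = f;
  compm1 : forall A B (f : hom A B), comp f (idm A) = f;
  compDl : forall A B C (g1 g2 : hom B C) (f : hom A B),
    comp (g1 + g2) f = comp g1 f + comp g2 f;
  compDr : forall A B C (g : hom B C) (f1 f2 : hom A B),
    comp g (f1 + f2) = comp g f1 + comp g f2;
  compZl : forall A B C (a : k) (g : hom B C) (f : hom A B),
    comp (a *: g) f = a *: comp g f;
  compZr : forall A B C (a : k) (g : hom B C) (f : hom A B),
    comp g (a *: f) = a *: comp g f
}.

Arguments hom {k l} A B.
Arguments idm {k l} A.
Notation "g \oc f" := (comp g f) : ring_scope.

HB.instance Definition _ (k : fieldType) (C : linCat k) := gen_eqMixin (ob C).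
HB.instance Definition _ (k : fieldType) (C : linCat k) :=
  gen_choiceMixin (ob C).

Section Categories.
Context {k : fieldType}.
Implicit Types C D : linCat k.

Definition is_zero C (A : C) : Prop := idm A = 0.

Definition is_iso C (A B : C) (f : hom A B) : Prop :=
  exists g : hom B A, g \oc f = idm A /\ f \oc g = idm B.

Definition isomorphic C (A B : C) : Prop := exists f : hom A B, is_iso f.

Definition is_biproduct C (A B S : C) : Prop :=
  exists (i1 : hom A S) (i2 : hom B S) (p1 : hom S A) (p2 : hom S B),
    [/\ p1 \oc i1 = idm A, p2 \oc i2 = idm B, p1 \oc i2 = 0, p2 \oc i1 = 0
      & i1 \oc p1 + i2 \oc p2 = idm S].

Definition additive_cat C : Prop :=
  (exists Z : C, is_zero Z) /\
  (forall A B : C, exists S : C, is_biproduct A B S).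

(* A full subcategory is given by its objects; it is understood to be closed
   under isomorphism. *)
Definition full_additive_sub C (P : C -> Prop) : Prop :=
  [/\ forall A, is_zero A -> P A,
      forall A B S, is_biproduct A B S -> P A -> P B -> P S
    & forall A B, isomorphic A B -> P A -> P B].

Record functor C D := Functor {
  fob :> C -> D;
  fmap : forall A B : C, hom A B -> hom (fob A) (fob B);
  fmap1 : forall A : C, fmap (idm A) = idm (fob A);
  fmapM : forall (A B E : C) (g : hom B E) (f : hom A B),
    fmap (g \oc f) = fmap g \oc fmap f;
  fmapD : forall (A B : C) (f g : hom A B), fmap (f + g) = fmap f + fmap g;
  fmapZ : forall (A B : C) (a : k) (f : hom A B), fmap (a *: f) = a *: fmap f
}.

Definition id_functor C : functor C C.
Proof. by exists id (fun A B f => f). Defined.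

Definition comp_functor C D E (G : functor D E) (F : functor C D) :
  functor C E.
Proof.
exists (fun A => G (F A)) (fun A B f => fmap G (fmap F f)).
- by move=> A; rewrite !fmap1.
- by move=> A B X g f; rewrite !fmapM.
- by move=> A B f g; rewrite !fmapD.
- by move=> A B a f; rewrite !fmapZ.
Defined.

Definition nat_iso C D (F G : functor C D) : Prop :=
  exists eta : forall A : C, hom (F A) (G A),
    (forall A, is_iso (eta A)) /\
    (forall (A B : C) (f : hom A B),
       eta B \oc fmap F f = fmap G f \oc eta A).

Definition quasi_inverse C D (F : functor C D) (G : functor D C) : Prop :=
  nat_iso (comp_functor G F) (id_functor C) /\
  nat_iso (comp_functor F G) (id_functor D).

End Categories.

(* The shift is an autoequivalence (not necessarily an automorphism), with
   chosen quasi-inverse [unshift]. Verdier's axioms are TR1 = dist_iso, dist_id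
   and dist_cone, TR2 = dist_rot, TR3 = dist_mor, TR4 = dist_oct. *)
Record triCat (k : fieldType) := TriCat {
  tri_cat :> linCat k;
  tri_additive : additive_cat tri_cat;
  shift : functor tri_cat tri_cat;
  unshift : functor tri_cat tri_cat;
  shift_equiv : quasi_inverse shift unshift;
  dist : forall A B C : tri_cat,
    hom A B -> hom B C -> hom C (shift A) -> Prop;
  dist_iso : forall (A B C A' B' C' : tri_cat)
    (f : hom A B) (g : hom B C) (h : hom C (shift A))
    (f' : hom A' B') (g' : hom B' C') (h' : hom C' (shift A'))
    (a : hom A A') (b : hom B B') (c : hom C C'),
    is_iso a -> is_iso b -> is_iso c ->
    b \oc f = f' \oc a -> c \oc g = g' \oc b ->
    fmap shift a \oc h = h' \oc c ->
    dist f g h -> dist f' g' h';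
  dist_id : forall A Z : tri_cat, is_zero Z ->
    dist (idm A) (0 : hom A Z) (0 : hom Z (shift A));
  dist_cone : forall (A B : tri_cat) (f : hom A B),
    exists (C : tri_cat) (g : hom B C) (h : hom C (shift A)), dist f g h;
  dist_rot : forall (A B C : tri_cat)
    (f : hom A B) (g : hom B C) (h : hom C (shift A)),
    dist f g h <-> dist g h (- fmap shift f);
  dist_mor : forall (A B C A' B' C' : tri_cat)
    (f : hom A B) (g : hom B C) (h : hom C (shift A))
    (f' : hom A' B') (g' : hom B' C') (h' : hom C' (shift A'))
    (a : hom A A') (b : hom B B'),
    dist f g h -> dist f' g' h' -> b \oc f = f' \oc a ->
    exists c : hom C C',
      c \oc g = g' \oc b /\ fmap shift a \oc h = h' \oc c;
  dist_oct : forall (A B C Cf Cg Cgf : tri_cat)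
    (f : hom A B) (g : hom B C)
    (pf : hom B Cf) (qf : hom Cf (shift A))
    (pg : hom C Cg) (qg : hom Cg (shift B))
    (pgf : hom C Cgf) (qgf : hom Cgf (shift A)),
    dist f pf qf -> dist g pg qg -> dist (g \oc f) pgf qgf ->
    exists (a : hom Cf Cgf) (b : hom Cgf Cg),
      [/\ dist a b (fmap shift pf \oc qg),
          a \oc pf = pgf \oc g, qgf \oc a = qf,
          b \oc pgf = pg & qg \oc b = fmap shift f \oc qgf]
}.

Section Triangulated.
Context {k : fieldType}.
Implicit Types T : triCat k.

Definition is_triangle T (A B C : T) : Prop :=
  exists (f : hom A B) (g : hom B C) (h : hom C (shift T A)), dist f g h.

Definition shiftz T (i : int) (E : T) : T :=
  match i with
  | Posz n => iter n (shift T) E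
  | Negz n => iter n.+1 (unshift T) E
  end.

(* An element of [\bigoplus_i Hom(E, F[i])] is a family with finite support. *)
Definition fin_supp T (E F : T) (g : forall i : int, hom E (shiftz i F)) :
    Prop :=
  exists s : seq int, forall i, i \notin s -> g i = 0.

Definition finite_type T : Prop :=
  forall E F : T, exists (n : nat)
    (b : 'I_n -> forall i : int, hom E (shiftz i F)),
    (forall l, fin_supp (b l)) /\
    (forall g : forall i : int, hom E (shiftz i F), fin_supp g ->
       exists c : 'I_n -> k, forall i, g i = \sum_(l < n) c l *: b l i).

Definition exact_functor T (F : functor T T) : Prop :=
  exists theta : forall A : T, hom (F (shift T A)) (shift T (F A)),
    [/\ forall A, is_iso (theta A),
        forall (A B : T) (f : hom A B),
          theta B \oc fmap F (fmap (shift T) f) =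
          fmap (shift T) (fmap F f) \oc theta A
      & forall (A B C : T)
          (f : hom A B) (g : hom B C) (h : hom C (shift T A)),
          dist f g h -> dist (fmap F f) (fmap F g) (theta A \oc fmap F h)].

(* Autoequivalences are k-linear ([functor] is) and exact; the group [Aut T]
   below consists of their natural isomorphism classes. *)
Record autoeq T := AutoEq {
  autoeq_fun :> functor T T;
  autoeqP : exact_functor autoeq_fun /\
    exists2 G : functor T T, exact_functor G & quasi_inverse autoeq_fun G
}.

End Triangulated.

HB.instance Definition _ (k : fieldType) (T : triCat k) :=
  gen_eqMixin (autoeq T).
HB.instance Definition _ (k : fieldType) (T : triCat k) :=
  gen_choiceMixin (autoeq T).

Section NatIso.
Context {k : fieldType}.
Implicit Types C D E : linCat k.

Lemma is_iso_id C (A : C) : is_iso (idm A).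
Proof. by exists (idm A); rewrite comp1m. Qed.

Lemma is_iso_comp C (X Y Z : C) (g : hom Y Z) (f : hom X Y) :
  is_iso g -> is_iso f -> is_iso (g \oc f).
Proof.
move=> [g' [g1 g2]] [f' [f1 f2]]; exists (f' \oc g'); split.
- by rewrite -compA (compA g') g1 comp1m.
- by rewrite -compA (compA f) f2 comp1m.
Qed.

Lemma is_iso_fmap C D (F : functor C D) (X Y : C) (f : hom X Y) :
  is_iso f -> is_iso (fmap F f).
Proof.
by move=> [g [g1 g2]]; exists (fmap F g); rewrite -!fmapM g1 g2 !fmap1.
Qed.

Lemma nat_iso_refl C D (F : functor C D) : nat_iso F F.
Proof.
exists (fun A => idm (F A)); split=> [A|A B f]; first exact: is_iso_id.
by rewrite comp1m compm1.
Qed.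

Lemma nat_iso_sym C D (F G : functor C D) : nat_iso F G -> nat_iso G F.
Proof.
move=> [eta [iso_eta nat_eta]].
exists (fun A => sval (cid (iso_eta A))); split=> [A|A B f].
  by case: cid => g [g1 g2] /=; exists (eta A).
case: cid => gB [gB1 gB2]; case: cid => gA [gA1 gA2] /=.
by rewrite -[LHS]compm1 -gA2 -compA (compA _ (eta A)) -nat_eta !compA gB1 comp1m.
Qed.

Lemma nat_iso_trans C D (F G H : functor C D) :
  nat_iso F G -> nat_iso G H -> nat_iso F H.
Proof.
move=> [e [ie ne]] [e' [ie' ne']].
exists (fun A => e' A \oc e A); split=> [A|A B f]; first exact: is_iso_comp.
by rewrite -compA ne compA ne' compA.
Qed.

Lemma nat_iso_comp C D E (G G' : functor D E) (F F' : functor C D) :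
  nat_iso G G' -> nat_iso F F' -> nat_iso (comp_functor G F) (comp_functor G' F').
Proof.
move=> [e [ie ne]] [e' [ie' ne']].
exists (fun A => e (F' A) \oc fmap G (e' A)); split=> [A|A B f] /=.
  by apply: is_iso_comp => //; exact: is_iso_fmap.
by rewrite -compA -fmapM ne' fmapM compA ne compA.
Qed.

Lemma nat_iso_compA B C D E (H : functor D E) (G : functor C D)
    (F : functor B C) :
  nat_iso (comp_functor H (comp_functor G F)) (comp_functor (comp_functor H G) F).
Proof.
exists (fun A => idm _); split=> [A|X Y f] /=; first exact: is_iso_id.
by rewrite comp1m compm1.
Qed.

Lemma nat_iso_comp1F C D (F : functor C D) :
  nat_iso (comp_functor (id_functor D) F) F.
Proof.
exists (fun A => idm _); split=> [A|X Y f] /=; first exact: is_iso_id.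
by rewrite comp1m compm1.
Qed.

Lemma nat_iso_compF1 C D (F : functor C D) :
  nat_iso (comp_functor F (id_functor C)) F.
Proof.
exists (fun A => idm _); split=> [A|X Y f] /=; first exact: is_iso_id.
by rewrite comp1m compm1.
Qed.

Lemma quasi_inverse_sym C D (F : functor C D) (G : functor D C) :
  quasi_inverse F G -> quasi_inverse G F.
Proof. by case. Qed.

Lemma quasi_inverse_comp C D E (F : functor C D) (F' : functor D C)
    (G : functor D E) (G' : functor E D) :
  quasi_inverse F F' -> quasi_inverse G G' ->
  quasi_inverse (comp_functor G F) (comp_functor F' G').
Proof.
suff gen (B1 B2 B3 : linCat k) (A : functor B1 B2) (A' : functor B2 B1) (H : functor B2 B3)
    (H' : functor B3 B2) :
    nat_iso (comp_functor A' A) (id_functor B1) ->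
    nat_iso (comp_functor H' H) (id_functor B2) ->
    nat_iso (comp_functor (comp_functor A' H') (comp_functor H A))
      (id_functor B1).
  by move=> [? ?] [? ?]; split; exact: gen.
move=> iA iH; apply: (nat_iso_trans _ iA).
apply: (nat_iso_trans (nat_iso_sym (nat_iso_compA _ _ _))).
apply: (nat_iso_comp (nat_iso_refl _)).
apply: (nat_iso_trans (nat_iso_compA _ _ _)).
apply: (nat_iso_trans (nat_iso_comp iH (nat_iso_refl _))).
exact: nat_iso_comp1F.
Qed.

End NatIso.

Section Aut.
Context {k : fieldType} (T : triCat k).
Implicit Types F G H : autoeq T.

Lemma exact_id : exact_functor (id_functor T).
Proof.
exists (fun A => idm _); split=> [A|A B f|A B C f g h] /=.
- exact: is_iso_id.
- by rewrite comp1m compm1.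
- by rewrite comp1m.
Qed.

Lemma exact_comp (G F : functor T T) :
  exact_functor G -> exact_functor F -> exact_functor (comp_functor G F).
Proof.
move=> [u [iu nu du]] [w [iw nw dw]].
exists (fun A => u (F A) \oc fmap G (w A)); split=> [A|A B f|A B C f g h] /=.
- by apply: is_iso_comp => //; exact: is_iso_fmap.
- by rewrite -compA -fmapM nw fmapM compA nu compA.
- by move=> /dw/du; rewrite fmapM compA.
Qed.

Definition autoeq1 : autoeq T.
Proof.
exists (id_functor T); split; first exact: exact_id.
exists (id_functor T); first exact: exact_id.
by split; exact: nat_iso_comp1F.
Defined.

Definition autoeqM G F : autoeq T.
Proof.
exists (comp_functor G F).
case: G F => [G [eG [G' eG' qG]]] [F [eF [F' eF' qF]]] /=.
split; first exact: exact_comp.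
exists (comp_functor F' G'); first exact: exact_comp.
exact: quasi_inverse_comp.
Defined.

Definition autoeqV F : autoeq T.
Proof.
pose G := cid2 (autoeqP F).2; exists (s2val G); split; first exact: s2valP G.
exists F; first exact: (autoeqP F).1.
exact: quasi_inverse_sym (s2valP' G).
Defined.

Lemma autoeqVP F : quasi_inverse F (autoeqV F).
Proof. exact: s2valP' (cid2 (autoeqP F).2). Qed.

Definition autoeq_equiv F G : bool := `[< nat_iso F G >].

Lemma autoeq_equiv_refl : reflexive autoeq_equiv.
Proof. by move=> F; apply/asboolP; exact: nat_iso_refl. Qed.

Lemma autoeq_equiv_sym : symmetric autoeq_equiv.
Proof. by move=> F G; apply/asboolP/asboolP; exact: nat_iso_sym. Qed.

Lemma autoeq_equiv_trans : transitive autoeq_equiv.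
Proof.
by move=> G F H /asboolP FG /asboolP GH; apply/asboolP/(nat_iso_trans FG).
Qed.

Canonical autoeq_equiv_rel := EquivRel autoeq_equiv
  autoeq_equiv_refl autoeq_equiv_sym autoeq_equiv_trans.
Canonical autoeq_equiv_direct := defaultEncModRel autoeq_equiv.

Definition Aut := {eq_quot autoeq_equiv}.
HB.instance Definition _ := Choice.on Aut.
HB.instance Definition _ := Quotient.on Aut.
HB.instance Definition _ : EqQuotient _ autoeq_equiv Aut := EqQuotient.on Aut.

Lemma AutP F G : \pi_Aut F = \pi_Aut G <-> nat_iso F G.
Proof.
split=> [/eqP|FG]; first by rewrite piE => /asboolP.
by apply/eqP; rewrite piE; apply/asboolP.
Qed.

Definition Aut1 : Aut := \pi_Aut autoeq1.
Definition AutM (a b : Aut) : Aut := \pi_Aut (autoeqM (repr a) (repr b)).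
Definition AutV (a : Aut) : Aut := \pi_Aut (autoeqV (repr a)).

Lemma nat_iso_repr F : nat_iso (repr (\pi_Aut F)) F.
Proof. by apply/AutP; rewrite reprK. Qed.

Lemma AutME F G : AutM (\pi_Aut F) (\pi_Aut G) = \pi_Aut (autoeqM F G).
Proof. by apply/AutP; apply: nat_iso_comp; exact: nat_iso_repr. Qed.

Lemma AutMA : associative AutM.
Proof.
elim/quotW=> F; elim/quotW=> G; elim/quotW=> H.
rewrite (AutME G H) (AutME F G) !AutME; apply/AutP; exact: nat_iso_compA.
Qed.

Lemma Aut1M : left_id Aut1 AutM.
Proof. by elim/quotW=> F; rewrite AutME; apply/AutP; exact: nat_iso_comp1F. Qed.

Lemma AutM1 : right_id Aut1 AutM.
Proof. by elim/quotW=> F; rewrite AutME; apply/AutP; exact: nat_iso_compF1. Qed.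

Lemma AutVM : left_inverse Aut1 AutV AutM.
Proof.
move=> a; rewrite -[a in AutM _ a]reprK AutME; apply/AutP.
by case: (autoeqVP (repr a)).
Qed.

Lemma AutMV : right_inverse Aut1 AutV AutM.
Proof.
move=> a; rewrite -[a in AutM a]reprK AutME; apply/AutP.
by case: (autoeqVP (repr a)).
Qed.

HB.instance Definition _ :=
  isGroup.Build Aut AutMA Aut1M AutM1 AutVM AutMV.

End Aut.

Section ZAut.
Context (L : zmodType).

(* [Aut_Z(L)] *)
Record zaut := ZAut {
  zaut_fun :> L -> L;
  zautP : {morph zaut_fun : x y / x + y} /\ bijective zaut_fun
}.

HB.instance Definition _ := gen_eqMixin zaut.
HB.instance Definition _ := gen_choiceMixin zaut.

Lemma zaut_ext (a b : zaut) : a =1 b -> a = b.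
Proof.
case: a b => [a aP] [b bP] /= /funext ab; case: _ / ab in bP *.
by congr ZAut; exact: Prop_irrelevance.
Qed.

Definition zaut1 : zaut.
Proof. by exists id; split=> //; exists id. Defined.

Definition zautM (a b : zaut) : zaut.
Proof.
exists (a \o b); case: a b => [a [aD aB]] [b [bD bB]] /=.
by split; [move=> x y /=; rewrite bD aD|exact: bij_comp].
Defined.

Lemma zaut_inv (a : zaut) : {b : L -> L | cancel a b & cancel b a}.
Proof. by apply: cid2; case: (zautP a).2 => b; exists b. Qed.

Definition zautV (a : zaut) : zaut.
Proof.
exists (s2val (zaut_inv a)); case: zaut_inv => b ab ba /=.
split; last by exists a.
by move=> x y; apply: (can_inj ab); rewrite (zautP a).1 !ba.
Defined.

Lemma zautVM : left_inverse zaut1 zautV zautM.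
Proof. by move=> a; apply: zaut_ext; exact: s2valP (zaut_inv a). Qed.

Lemma zautMV : right_inverse zaut1 zautV zautM.
Proof. by move=> a; apply: zaut_ext; exact: s2valP' (zaut_inv a). Qed.

Lemma zautMA : associative zautM. Proof. by move=> a b c; exact: zaut_ext. Qed.
Lemma zaut1M : left_id zaut1 zautM. Proof. by move=> a; exact: zaut_ext. Qed.
Lemma zautM1 : right_id zaut1 zautM. Proof. by move=> a; exact: zaut_ext. Qed.

HB.instance Definition _ :=
  isGroup.Build zaut zautMA zaut1M zautM1 zautVM zautMV.

End ZAut.

Section K0.
Context {k : fieldType} (T : triCat k).

Local Notation FT := {freeg (ob T) / int}.

Inductive K0_rel : FT -> Prop :=
  | K0_rel0 : K0_rel 0
  | K0_relB x y : K0_rel x -> K0_rel y -> K0_rel (x - y)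
  | K0_relT (A B C : T) : is_triangle A B C ->
      K0_rel (<< B >> - << A >> - << C >>).

Definition K0_eqv (x y : FT) : bool := `[< K0_rel (x - y) >].

Lemma K0_relN x : K0_rel x -> K0_rel (- x).
Proof. by move=> rx; rewrite -sub0r; apply: K0_relB => //; exact: K0_rel0. Qed.

Lemma K0_relD x y : K0_rel x -> K0_rel y -> K0_rel (x + y).
Proof. by move=> rx /K0_relN ry; rewrite -[y]opprK; exact: K0_relB. Qed.

Lemma K0_eqv_refl : reflexive K0_eqv.
Proof. by move=> x; apply/asboolP; rewrite subrr; exact: K0_rel0. Qed.

Lemma K0_eqv_sym : symmetric K0_eqv.
Proof.
by move=> x y; apply/asboolP/asboolP => /K0_relN; rewrite opprB.
Qed.

Lemma K0_eqv_trans : transitive K0_eqv.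
Proof.
move=> y x z /asboolP xy /asboolP yz; apply/asboolP.
by rewrite -(subrK y x) -addrA; exact: K0_relD.
Qed.

Canonical K0_eqv_rel := EquivRel K0_eqv K0_eqv_refl K0_eqv_sym K0_eqv_trans.
Canonical K0_eqv_direct := defaultEncModRel K0_eqv.

Definition K0 := {eq_quot K0_eqv}.
HB.instance Definition _ := Choice.on K0.
HB.instance Definition _ := Quotient.on K0.
HB.instance Definition _ : EqQuotient _ K0_eqv K0 := EqQuotient.on K0.

Lemma K0P (x y : FT) : \pi_K0 x = \pi_K0 y <-> K0_rel (x - y).
Proof.
split=> [/eqP|xy]; first by rewrite piE => /asboolP.
by apply/eqP; rewrite piE; apply/asboolP.
Qed.

Definition K0_zero : K0 := \pi_K0 0.
Definition K0_opp (a : K0) : K0 := \pi_K0 (- repr a).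
Definition K0_add (a b : K0) : K0 := \pi_K0 (repr a + repr b).

Lemma K0_repr (x : FT) : K0_rel (repr (\pi_K0 x) - x).
Proof. by apply/K0P; rewrite reprK. Qed.

Lemma K0_addE (x y : FT) : K0_add (\pi_K0 x) (\pi_K0 y) = \pi_K0 (x + y).
Proof.
by apply/K0P; rewrite opprD addrACA; apply: K0_relD; exact: K0_repr.
Qed.

Lemma K0_oppE (x : FT) : K0_opp (\pi_K0 x) = \pi_K0 (- x).
Proof. by apply/K0P; rewrite -opprD; apply: K0_relN; exact: K0_repr. Qed.

Lemma K0_addA : associative K0_add.
Proof.
elim/quotW=> x; elim/quotW=> y; elim/quotW=> z.
by rewrite (K0_addE y z) (K0_addE x y) !K0_addE addrA.
Qed.

Lemma K0_addC : commutative K0_add.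
Proof. by elim/quotW=> x; elim/quotW=> y; rewrite !K0_addE addrC. Qed.

Lemma K0_add0 : left_id K0_zero K0_add.
Proof. by elim/quotW=> x; rewrite K0_addE add0r. Qed.

Lemma K0_addN : left_inverse K0_zero K0_opp K0_add.
Proof. by elim/quotW=> x; rewrite (K0_oppE x) K0_addE addNr. Qed.

HB.instance Definition _ :=
  GRing.isZmodule.Build K0 K0_addA K0_addC K0_add0 K0_addN.

Definition K0_class (E : T) : K0 := \pi_K0 << E >>.

(* The endomorphism [E] |-> [F E] of K0; K0_map_class and K0_map_additive
   characterize it. *)
Definition K0_map (F : autoeq T) (a : K0) : K0 :=
  \pi_K0 (fglift (fun E : ob T => << F E >> : FT) (repr a)).

End K0.

Section K0Theory.
Context {k : fieldType} (T : triCat k).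

Local Notation FT := {freeg (ob T) / int}.

Let lift (F : autoeq T) : FT -> FT := fglift (fun E : ob T => << F E >> : FT).

Let liftB (F : autoeq T) : {morph lift F : x y / x - y}.
Proof. exact: lift_is_additive. Qed.

Let lift0 (F : autoeq T) : lift F 0 = 0.
Proof. by rewrite -[0 in LHS]subr0 liftB subrr. Qed.

Let liftD (F : autoeq T) : {morph lift F : x y / x + y}.
Proof. by move=> x y; rewrite -{1}[y]opprK -[- y]sub0r !liftB lift0 sub0r opprK. Qed.

Let lift_class (F : autoeq T) E : lift F << E >> = << F E >>.
Proof. by rewrite /lift liftU scale1r. Qed.

Let lift_rel (F : autoeq T) x : K0_rel x -> K0_rel (lift F x).
Proof.
elim=> [|{}x y _ IHx _ IHy|A B C [f [g [h dfgh]]]].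
- by rewrite lift0; exact: K0_rel0.
- by rewrite liftB; exact: K0_relB.
rewrite !liftB !lift_class; apply: K0_relT.
have [[theta [_ _ dF]] _] := autoeqP F.
by exists (fmap F f), (fmap F g), (theta A \oc fmap F h); exact: dF.
Qed.

Let K0_mapE (F : autoeq T) (x : FT) :
  K0_map F (\pi_(K0 T) x) = \pi_(K0 T) (lift F x).
Proof. by apply/K0P; rewrite -liftB; apply: lift_rel; exact: K0_repr. Qed.

Lemma K0_map_class (F : autoeq T) E : K0_map F (K0_class E) = K0_class (F E).
Proof. by rewrite K0_mapE lift_class. Qed.

Lemma K0_map_additive (F : autoeq T) : {morph K0_map F : a b / a + b}.
Proof.
elim/quotW=> x; elim/quotW=> y.
have -> : \pi_(K0 T) x + \pi_(K0 T) y = \pi_(K0 T) (x + y) := K0_addE x y.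
by rewrite !K0_mapE liftD -[LHS]K0_addE.
Qed.

Lemma K0_class_triangle (A B C : T) :
  is_triangle A B C -> K0_class B = K0_class A + K0_class C.
Proof.
move=> tri; rewrite [RHS]K0_addE; apply/K0P.
by rewrite opprD addrA; exact: K0_relT.
Qed.

End K0Theory.

(* [j] exhibits [V] as the extension of scalars of the free abelian group [L]
   with basis [e]: it maps the Z-basis [e] to an R-basis of [V]. *)
Definition is_Zbasis (L : zmodType) (n : nat) (e : 'I_n -> L) : Prop :=
  forall x : L, exists! c : 'I_n -> int, x = \sum_(i < n) e i *~ c i.

Definition is_Rbasis (R : realType) (V : lmodType R) (n : nat)
    (e : 'I_n -> V) : Prop :=
  forall x : V, exists! c : 'I_n -> R, x = \sum_(i < n) c i *: e i.

Section Stability.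
Context {R : realType} {k : fieldType} {T : triCat k} {L : zmodType}.
Variables (v : {additive K0 T -> L}).
Variables (V : normedModType R) (j : {additive L -> V}).

(* [hn_obj i] and [hn_fac i] are the objects E_i and A_(i+1) of the
   Harder-Narasimhan filtration, [hn_phase i] is the phase of A_(i+1). *)
Record HN (P : R -> T -> Prop) (E : T) := MkHN {
  hn_len : nat;
  hn_obj : nat -> T;
  hn_fac : nat -> T;
  hn_phase : nat -> R;
  hn_obj0 : is_zero (hn_obj 0);
  hn_objE : hn_obj hn_len = E;
  hn_tri : forall i, (i < hn_len)%N ->
    is_triangle (hn_obj i) (hn_obj i.+1) (hn_fac i);
  hn_facP : forall i, (i < hn_len)%N ->
    ~ is_zero (hn_fac i) /\ P (hn_phase i) (hn_fac i);
  hn_phase_lt : forall i i', (i < i' < hn_len)%N -> hn_phase i' < hn_phase i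
}.

Record stability := Stability {
  st_Z : {additive L -> R[i]};
  st_P : R -> T -> Prop;
  st_additive : forall phi, full_additive_sub (st_P phi);
  st_phase : forall phi E, st_P phi E -> ~ is_zero E ->
    exists2 m : R, 0 < m &
      st_Z (v (K0_class E)) =
        m%:C%C * (cos (pi * phi) +i* sin (pi * phi))%C;
  st_shift : forall phi E, st_P (phi + 1) E <->
    exists2 E' : T, st_P phi E' & isomorphic E (shift T E');
  st_hom : forall phi1 phi2 E1 E2, phi2 < phi1 ->
    st_P phi1 E1 -> st_P phi2 E2 -> forall f : hom E1 E2, f = 0;
  st_HN : forall E, ~ is_zero E -> inhabited (HN st_P E);
  st_support : exists2 C : R, 0 < C &
    forall phi E, st_P phi E -> ~ is_zero E ->
      `|j (v (K0_class E))| < C * Normc.normc (st_Z (v (K0_class E)))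
}.

HB.instance Definition _ := gen_eqMixin stability.
HB.instance Definition _ := gen_choiceMixin stability.

(* Harder-Narasimhan filtrations are unique up to isomorphism, so that the
   values below do not depend on the choice made by [xget]; they are only used
   for nonzero [E]. *)
Definition phi_plus (s : stability) (E : T) : R :=
  xget 0 [set hn_phase h 0 | h in [set: HN (st_P s) E]].

Definition phi_minus (s : stability) (E : T) : R :=
  xget 0 [set hn_phase h (hn_len h).-1 | h in [set: HN (st_P s) E]].

Definition mass (s : stability) (E : T) : R :=
  xget 0 [set \sum_(i < hn_len h)
                 Normc.normc (st_Z s (v (K0_class (hn_fac h i))))
         | h in [set: HN (st_P s) E]].

Definition dB (s t : stability) : \bar R :=
  ereal_sup [set x | exists2 E : T, ~ is_zero E &
    [\/ x = `|phi_plus s E - phi_plus t E|%:E,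
        x = `|phi_minus s E - phi_minus t E|%:E
      | x = `|ln (mass s E / mass t E)|%:E]].

Lemma mass_gt0 (s : stability) (E : T) : ~ is_zero E -> 0 < mass s E.
Proof.
move=> E0; have [h0] := st_HN s E0.
suff [h _ <-] : [set \sum_(i < hn_len h)
      Normc.normc (st_Z s (v (K0_class (hn_fac h i))))
    | h in [set: HN (st_P s) E]] (mass s E); last first.
  by apply: xgetPex; eexists; exists h0.
have n0 : (0 < hn_len h)%N.
  rewrite lt0n; apply/eqP => n0; apply: E0.
  by rewrite -(hn_objE h) n0; exact: hn_obj0.
have pos (i : 'I_(hn_len h)) :
    0 < Normc.normc (st_Z s (v (K0_class (hn_fac h i)))).
  have [A0 PA] := hn_facP (ltn_ord i).
  have [m m0 ->] := st_phase PA A0; rewrite Normc.normcM /=.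
  by rewrite cos2Dsin2 sqrtr1 mulr1 expr0n addr0 sqrtr_sqr normr_gt0 gt_eqF.
rewrite (bigD1 (Ordinal n0)) //=; apply: ltr_wpDr (pos (Ordinal n0)).
by apply: sumr_ge0 => i _; exact: ltW.
Qed.

Lemma dB_sym (s t : stability) : dB s t = dB t s.
Proof.
suff le (a b : stability) : (dB a b <= dB b a)%E by apply/eqP; rewrite eq_le !le.
apply: le_ereal_sup => x [E E0 Ex].
exists E => //; case: Ex => ->.
- by apply: Or31; rewrite distrC.
- by apply: Or32; rewrite distrC.
- by apply: Or33; rewrite -invf_div lnV ?normrN// posrE divr_gt0 ?mass_gt0.
Qed.

Lemma dB_triangle (s t u : stability) : (dB s u <= dB s t + dB t u)%E.
Proof.
apply: ge_ereal_sup => x [E E0].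
have bnd (a b c : R) : `|a| <= `|b| + `|c| ->
    (`|b|%:E <= dB s t)%E -> (`|c|%:E <= dB t u)%E ->
    (`|a|%:E <= dB s t + dB t u)%E.
  by move=> abc b1 c1; apply: le_trans (leeD b1 c1); rewrite lee_fin.
case=> ->.
- apply: (bnd _ _ _ (ler_distD (phi_plus t E) _ _));
    by apply: ereal_sup_ubound; exists E => //; apply: Or31.
- apply: (bnd _ _ _ (ler_distD (phi_minus t E) _ _));
    by apply: ereal_sup_ubound; exists E => //; apply: Or32.
- have lnE (a b : stability) : ln (mass a E / mass b E) =
      ln (mass a E) - ln (mass b E) by rewrite ln_div ?posrE ?mass_gt0.
  apply: (bnd _ (ln (mass s E / mass t E)) (ln (mass t E / mass u E))).
  + by rewrite !lnE ler_distD.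
  + by apply: ereal_sup_ubound; exists E => //; apply: Or33.
  + by apply: ereal_sup_ubound; exists E => //; apply: Or33.
Qed.

(* The topology of the generalized metric dB, defined by its balls *)
Definition dB_ball (s : stability) (e : R) : set stability :=
  [set t | (dB s t < e%:E)%E].

Lemma dB_ball_center s (e : R) : 0 < e -> dB_ball s e s.
Proof.
move=> e0; rewrite /dB_ball /=; apply: (@le_lt_trans _ _ 0%E); last by rewrite lte_fin.
apply: ge_ereal_sup => x [E E0 [] ->]; rewrite ?subrr ?normr0//.
by rewrite divff ?ln1 ?normr0// gt_eqF// mass_gt0.
Qed.

Lemma dB_ball_sym s t (e : R) : dB_ball s e t -> dB_ball t e s.
Proof. by rewrite /dB_ball /= dB_sym. Qed.

Lemma dB_ball_triangle s t u (e1 e2 : R) :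
  dB_ball s e1 t -> dB_ball t e2 u -> dB_ball s (e1 + e2) u.
Proof.
move=> st tu; apply: le_lt_trans (dB_triangle s t u) _.
by rewrite EFinD lteD.
Qed.

Definition dB_ent : set_system (stability * stability) := entourage_ dB_ball.
Definition dB_nbhs (s : stability) : set_system stability := nbhs_ dB_ent s.

HB.instance Definition _ := hasNbhs.Build stability dB_nbhs.
HB.instance Definition _ := @Nbhs_isPseudoMetric.Build R stability
  dB_ent erefl dB_ball dB_ball_center dB_ball_sym dB_ball_triangle erefl.

End Stability.

Section MetricGeometry.
Context {R : realType} {X : topologicalType}.
Variables (d : X -> X -> \bar R) (A : set X).

Definition is_geodesic (x y : X) (g : R -> X) : Prop :=
  [/\ {within `[0, 1], continuous g}, g 0 = x, g 1 = y,
      (forall t, t \in `[0, 1] -> A (g t))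
    & forall t t', t \in `[0, 1] -> t' \in `[0, 1] ->
        d (g t) (g t') = (d x y * `|t - t'|%:E)%E].

Definition geodesic_space : Prop :=
  forall x y, A x -> A y -> x <> y -> exists g, is_geodesic x y g.

(* The vertices are indexed by 'I_3, with addition modulo 3; the i-th side goes
   from the i-th vertex to the next one. *)
Definition is_geodesic_triangle (x : 'I_3 -> X) (g : 'I_3 -> R -> X) : Prop :=
  forall i, A (x i) /\ is_geodesic (x i) (x (i + 1)) (g i).

Definition euclid (p q : 'rV[R]_2) : R :=
  Num.sqrt (\sum_(l < 2) (p 0 l - q 0 l) ^+ 2).

Definition is_comparison_triangle (x : 'I_3 -> X) (p : 'I_3 -> 'rV[R]_2) : Prop :=
  forall i, (euclid (p i) (p (i + 1)))%:E = d (x i) (x (i + 1)).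

Definition comparison_point (p : 'I_3 -> 'rV[R]_2) (i : 'I_3) (t : R) :
    'rV[R]_2 :=
  (1 - t) *: p i + t *: p (i + 1).

Definition CAT0 : Prop :=
  geodesic_space /\
  forall x g p, is_geodesic_triangle x g -> is_comparison_triangle x p ->
    forall (i i' : 'I_3) (t t' : R), t \in `[0, 1] -> t' \in `[0, 1] ->
      (d (g i t) (g i' t') <=
       (euclid (comparison_point p i t) (comparison_point p i' t'))%:E)%E.

Definition Gromov_hyperbolic : Prop :=
  exists2 delta : R, 0 < delta &
    geodesic_space /\
    forall x g, is_geodesic_triangle x g ->
      forall (i : 'I_3) (t : R), t \in `[0, 1] ->
        exists (i' : 'I_3) (t' : R),
          [/\ i' != i, t' \in `[0, 1] & (d (g i t) (g i' t') < delta%:E)%E].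

End MetricGeometry.

(* Main.v *)
(* The additive group R x R acts on stability conditions: (a, b) shifts all
   phases by a and multiplies the central charge by exp (b + i pi a), so that
   phi^+ and phi^- increase by a and the mass is multiplied by e^b. Hence each
   orbit is an isometric copy of the plane with the sup norm, it is connected,
   and its affine segments are geodesics. In that plane the triangle
   (0, 0), (N, N), (2N, 0) has degenerate comparison triangle, although its apex
   is at distance N from the midpoint of the base; and no point of the two upper
   sides is closer than N / 2 to that midpoint. *)
Require Import Defs.
From HB Require Import structures.
From mathcomp Require Import all_boot all_order all_algebra.
From mathcomp Require Import complex.
From mathcomp.multinomials Require Import freeg.
From mathcomp Require Import all_classical all_reals all_analysis.
From mathcomp Require Import lra.
Import Order.TTheory GRing.Theory Num.Theory.
Import numFieldNormedType.Exports.
(* [hom] and [shift] must denote those of Defs, not MathComp's. *)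
Import Defs.

Set Implicit Arguments.
Unset Strict Implicit.
Unset Printing Implicit Defensive.

Local Open Scope classical_set_scope.
Local Open Scope ring_scope.
Local Open Scope quotient_scope.

(** * Zero objects and isomorphisms in linear categories *)

Section LinearCategory.
Context {k : fieldType} {C : linCat k}.
Implicit Types A B D : C.

Lemma comp0m A B D (f : hom A B) : (0 : hom B D) \oc f = 0.
Proof. by rewrite -[0 in LHS](scale0r 0) compZl scale0r. Qed.

Lemma compm0 A B D (g : hom B D) : g \oc (0 : hom A B) = 0.
Proof. by rewrite -[0 in LHS](scale0r 0) compZr scale0r. Qed.

Lemma compNm A B D (g : hom B D) (f : hom A B) : (- g) \oc f = - (g \oc f).
Proof. by rewrite -scaleN1r compZl scaleN1r. Qed.

Lemma compmN A B D (g : hom B D) (f : hom A B) : g \oc (- f) = - (g \oc f).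
Proof. by rewrite -scaleN1r compZr scaleN1r. Qed.

Lemma fmap0 (D : linCat k) (F : functor C D) A B : fmap F (0 : hom A B) = 0.
Proof. by rewrite -[0 in LHS](scale0r 0) fmapZ scale0r. Qed.

Lemma from_zero A B (f : hom A B) : is_zero A -> f = 0.
Proof. by move=> A0; rewrite -[f]compm1 A0 compm0. Qed.

Lemma is_zero_fob (D : linCat k) (F : functor C D) A :
  is_zero A -> is_zero (F A).
Proof. by rewrite /is_zero -fmap1 => ->; rewrite fmap0. Qed.

Lemma isomorphic_refl A : isomorphic A A.
Proof. by exists (idm A); exact: is_iso_id. Qed.

Lemma isomorphic_sym A B : isomorphic A B -> isomorphic B A.
Proof. by move=> [f [g [gf fg]]]; exists g, f. Qed.

Lemma isomorphic_trans A B D :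
  isomorphic A B -> isomorphic B D -> isomorphic A D.
Proof. by move=> [f fI] [g gI]; exists (g \oc f); exact: is_iso_comp. Qed.

Lemma isomorphic_fob (D : linCat k) (F : functor C D) A B :
  isomorphic A B -> isomorphic (F A) (F B).
Proof. by move=> [f fI]; exists (fmap F f); exact: is_iso_fmap. Qed.

Lemma is_iso_unipotent A (d : hom A A) :
  d \oc d = 0 -> is_iso (idm A + d).
Proof.
move=> dd; exists (idm A - d); split.
  by rewrite compDl comp1m compNm compDr compm1 dd addr0 addrK.
by rewrite compDr compm1 compmN compDl comp1m dd addr0 addrK.
Qed.

(** The left inverse [l \oc g] and the right inverse [g \oc r] of [f] coincide. *)
Lemma is_iso_of_comp A B (f : hom A B) (g : hom B A) :
  is_iso (g \oc f) -> is_iso (f \oc g) -> is_iso f.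
Proof.
move=> [l [lgf _]] [r [_ fgr]].
have E : l \oc g = g \oc r by rewrite -[LHS]compm1 -fgr !compA -(compA l) lgf comp1m.
by exists (l \oc g); split; [rewrite -compA | rewrite E compA].
Qed.

End LinearCategory.

(** * Vanishing of maps and comparison of distinguished triangles *)

Section TriangulatedCategory.
Context {k : fieldType} {T : triCat k}.
Implicit Types A B C W : T.

Lemma isomorphic_shift A B :
  isomorphic (shift T A) (shift T B) -> isomorphic A B.
Proof.
move=> /(isomorphic_fob (unshift T)) AB.
have [[eta [etaI _]] _] := shift_equiv T.
have unit X : isomorphic (unshift T (shift T X)) X.
  by exists (eta X); exact: etaI.
exact: isomorphic_trans (isomorphic_sym (unit A)) (isomorphic_trans AB (unit B)).
Qed.

(** TR3 fills in [c] for a map from the given triangle to the triangle [0 -> W = W]. *)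
Lemma dist_weak_cokernel A B C W (f : hom A B) (g : hom B C)
    (h : hom C (shift T A)) (w : hom B W) :
  dist f g h -> w \oc f = 0 -> exists c : hom C W, w = c \oc g.
Proof.
move=> fgh wf; have [[Z Z0] _] := tri_additive T.
(* Rotating it once gives the identity triangle of [W], whose third vertex [shift T Z] is again
   zero. *)
have tW : dist (0 : hom Z W) (idm W) (0 : hom W (shift T Z)).
  apply/dist_rot; rewrite fmap0 oppr0.
  by apply: dist_id; exact: is_zero_fob.
have [|c [cg _]] := dist_mor (a := 0) (b := w) fgh tW; first by rewrite wf compm0.
by exists c; rewrite cg comp1m.
Qed.

Definition hom_zero A B := forall f : hom A B, f = 0.

Lemma hom_zero_iso A A' B : isomorphic A A' -> hom_zero A' B -> hom_zero A B.
Proof.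
move=> [u [u' [u'u _]]] A'B f.
by rewrite -[f]compm1 -u'u compA (A'B (f \oc u')) comp0m.
Qed.

Lemma hom_zero_triangle A B C W :
  is_triangle A B C -> hom_zero A W -> hom_zero C W -> hom_zero B W.
Proof.
move=> [f [g [h fgh]]] AW CW w.
have [|c ->] := dist_weak_cokernel (w := w) fgh; first by rewrite (AW (w \oc f)).
by rewrite (CW c) comp0m.
Qed.

Lemma is_triangle_shift A B C :
  is_triangle A B C -> is_triangle (shift T A) (shift T B) (shift T C).
Proof.
by move=> [f [g [h /dist_rot/dist_rot/dist_rot fgh]]]; do 3 eexists; exact: fgh.
Qed.

(* [c - 1] factors through [- fmap shift f], which kills it: it has square zero. *)
Lemma is_iso_triangle_endo A B C (f : hom A B) (g : hom B C)
    (h : hom C (shift T A)) (c : hom C C) :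
  dist f g h -> c \oc g = g -> h \oc c = h -> is_iso c.
Proof.
move=> fgh cg hc.
have [|s sE] := dist_weak_cokernel (w := c - idm C) ((dist_rot _ _ _).1 fgh).
  by rewrite compDl compNm cg comp1m subrr.
rewrite -(subrK (idm C) c) addrC; apply: is_iso_unipotent.
by rewrite {1}sE -compA compDr compmN hc compm1 subrr compm0.
Qed.

(* If the projection to A vanished, A would be a direct summand of X[1]. *)
Lemma triangle_hom_zero X E A :
  is_triangle X E A -> hom_zero (shift T X) A -> hom_zero E A -> is_zero A.
Proof.
move=> [f [g [h fgh]]] XA EA.
have [|c] := dist_weak_cokernel (w := idm A) ((dist_rot _ _ _).1 fgh).
  by rewrite comp1m (EA g).
by rewrite (XA c) comp0m.
Qed.

(** Vanishing of maps out of [X] and [X'] makes [u] and [u'] descend to [A] and [A']; vanishing out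
    of their shifts makes the descended maps unique, hence mutually inverse. *)
Lemma triangle_iso X E A X' E' A' :
  is_triangle X E A -> is_triangle X' E' A' ->
  hom_zero X A' -> hom_zero X' A ->
  hom_zero (shift T X) A -> hom_zero (shift T X') A' ->
  isomorphic E E' -> isomorphic X X' /\ isomorphic A A'.
Proof.
move=> [f [g [h fgh]]] [f' [g' [h' fgh']]] XA' X'A XA XA'' [u [u' [uu' u'u]]].
have [|c cg] := dist_weak_cokernel (w := g' \oc u) fgh; first exact: XA'.
have [|c' cg'] := dist_weak_cokernel (w := g \oc u') fgh'; first exact: X'A.
have cancel_proj Y F B (p : hom Y F) (q : hom F B) (r : hom B (shift T Y)) w :
    dist p q r -> hom_zero (shift T Y) B -> w \oc q = q -> w = idm B.
  move=> /dist_rot pqr YB wq.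
  have [|d dE] := dist_weak_cokernel (w := w - idm B) pqr.
    by rewrite compDl compNm wq comp1m subrr.
  by apply/eqP; rewrite -subr_eq0 dE (YB d) comp0m.
have cc' : c' \oc c = idm A.
  by apply: cancel_proj fgh XA _; rewrite -compA -cg compA -cg' -compA uu' compm1.
have c'c : c \oc c' = idm A'.
  by apply: cancel_proj fgh' XA'' _; rewrite -compA -cg' compA -cg -compA u'u compm1.
split; last by exists c, c'.
(* TR3 on the rotated triangles gives maps between [shift T X] and [shift T X']. They need not be
   unique, so their composites may differ from the identity, but these respect the triangle and so
   are isomorphisms. *)
have rfgh := (dist_rot _ _ _).1 fgh; have rfgh' := (dist_rot _ _ _).1 fgh'.
have [a [ah af]] := dist_mor rfgh rfgh' (esym cg).
have [a' [ah' af']] := dist_mor rfgh' rfgh (esym cg').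
apply: isomorphic_shift; exists a; apply: (is_iso_of_comp (g := a')).
  apply: is_iso_triangle_endo rfgh _ _.
    by rewrite -compA ah compA ah' -compA cc' compm1.
  by rewrite compA -af' -compA -af compA -fmapM uu' fmap1 comp1m.
apply: is_iso_triangle_endo rfgh' _ _.
  by rewrite -compA ah' compA ah -compA c'c compm1.
by rewrite compA -af -compA -af' compA -fmapM u'u fmap1 comp1m.
Qed.

Lemma K0_class_zero A : is_zero A -> K0_class A = 0.
Proof.
move=> A0; have /K0_class_triangle AA : is_triangle A A A.
  by exists (idm A), 0, 0; exact: dist_id.
by apply: (addrI (K0_class A)); rewrite addr0 -AA.
Qed.

Lemma K0_class_iso A B : isomorphic A B -> K0_class A = K0_class B.
Proof.
move=> [f fI]; have [[Z Z0] _] := tri_additive T.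
suff /K0_class_triangle -> : is_triangle A B Z by rewrite (K0_class_zero Z0) addr0.
exists f, 0, 0.
apply: dist_iso (is_iso_id A) fI (is_iso_id Z) _ _ _ (dist_id A Z0).
all: by rewrite ?compm0 ?comp0m.
Qed.

End TriangulatedCategory.

(** * Uniqueness of Harder-Narasimhan filtrations *)

Section HarderNarasimhan.
Context {R : realType} {k : fieldType} {T : triCat k}.
Variable P : R -> T -> Prop.
Hypothesis P_hom : forall phi1 phi2 E1 E2, phi2 < phi1 ->
  P phi1 E1 -> P phi2 E2 -> hom_zero E1 E2.
Hypothesis P_shift : forall phi E, P phi E -> P (phi + 1) (shift T E).

(** Induction along the filtration, whose factors below [i] all have phase above [psi]. Shifting
    only raises phases, which gives the second half, needed to compare triangles. *)
Lemma HN_hom_zero E (h : HN P E) psi B i :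
  (forall l, (l < i)%N -> psi < hn_phase h l) -> P psi B ->
  (i <= hn_len h)%N ->
  hom_zero (hn_obj h i) B /\ hom_zero (shift T (hn_obj h i)) B.
Proof.
move=> + PB; elim: i => [_ _|i IH lt_psi i_lt].
  by split=> f; apply: from_zero; [|apply: is_zero_fob]; exact: hn_obj0.
have [l lt_i||H1 H2] := IH; [by apply: lt_psi; exact: ltnW|exact: ltnW|].
have [_ PA] := hn_facP i_lt; have psi_lt := lt_psi i (ltnSn i).
split; [apply: hom_zero_triangle (hn_tri i_lt) H1 _
       |apply: hom_zero_triangle (is_triangle_shift (hn_tri i_lt)) H2 _].
  exact: P_hom PA PB.
by apply: P_hom (P_shift PA) PB; rewrite (lt_trans psi_lt)// ltrDl.
Qed.

Definition HN_truncate E (h : HN P E) (i : nat) (hi : (i <= hn_len h)%N) :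
  HN P (hn_obj h i).
Proof.
exists i (hn_obj h) (hn_fac h) (hn_phase h) => //.
- exact: hn_obj0.
- by move=> l li; apply: hn_tri; exact: leq_trans hi.
- by move=> l li; apply: hn_facP; exact: leq_trans hi.
- by move=> l l' /andP[ll' li]; apply: hn_phase_lt; rewrite ll' (leq_trans li).
Defined.

(** Otherwise the last factor of [h'] would receive only zero maps from [E'] and from the shift of
    the preceding object, hence vanish. The case [hn_len h = 0] is included and settles empty
    filtrations in [HN_unique]. *)
Lemma HN_last_phase E E' (h : HN P E) (h' : HN P E') i :
  isomorphic E E' -> hn_len h' = i.+1 ->
  ~ (forall l, (l < hn_len h)%N -> hn_phase h' i < hn_phase h l).
Proof.
move=> EE' len' gt_i.
have i_lt : (i < hn_len h')%N by rewrite len'.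
have [A0 PA] := hn_facP i_lt; apply: A0.
apply: triangle_hom_zero (hn_tri i_lt) _ _.
  apply: (HN_hom_zero _ PA (ltnW i_lt)).2 => l li.
  by apply: hn_phase_lt; rewrite li.
rewrite -len' hn_objE; apply: hom_zero_iso (isomorphic_sym EE') _.
by rewrite -(hn_objE h); exact: (HN_hom_zero gt_i PA (leqnn _)).1.
Qed.

(* Induction on the last factor, so that no quotient of E (hence no octahedron)
   is needed. *)
Theorem HN_unique E E' (h : HN P E) (h' : HN P E') : isomorphic E E' ->
  hn_len h = hn_len h' /\ (forall i, (i < hn_len h)%N ->
    hn_phase h i = hn_phase h' i /\ isomorphic (hn_fac h i) (hn_fac h' i)).
Proof.
move: {2}(hn_len h) (erefl (hn_len h)) => n.
elim: n E E' h h' => [|n IH] E E' h h' len EE'.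
  case len' : (hn_len h') => [|i]; first by rewrite len.
  by case: (HN_last_phase (h := h) EE' len') => l; rewrite len.
case len' : (hn_len h') => [|n'].
  by case: (HN_last_phase (h := h') (isomorphic_sym EE') len) => l; rewrite len'.
(* Kept general in both filtrations, so that swapping them gives the reverse inequality. *)
have le_phase D D' (g : HN P D) (g' : HN P D') m m' : isomorphic D D' ->
    hn_len g = m.+1 -> hn_len g' = m'.+1 -> hn_phase g m <= hn_phase g' m'.
  move=> DD' glen glen'; rewrite leNgt; apply/negP => lt_last.
  apply: (HN_last_phase (h := g) DD' glen') => l; rewrite glen ltnS leq_eqVlt.
  case/predU1P => [->//|lm]; apply: lt_trans lt_last _.
  by apply: hn_phase_lt; rewrite lm glen /=.
have eq_last : hn_phase h n = hn_phase h' n'.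
  by apply/eqP; rewrite eq_le !le_phase//; exact: isomorphic_sym.
have n_lt : (n < hn_len h)%N by rewrite len.
have n'_lt : (n' < hn_len h')%N by rewrite len'.
have [_ PA] := hn_facP n_lt; have [_ PA'] := hn_facP n'_lt.
have X0 B : P (hn_phase h n) B ->
    hom_zero (hn_obj h n) B /\ hom_zero (shift T (hn_obj h n)) B.
  move=> PB; apply: HN_hom_zero PB (ltnW n_lt) => l ln.
  by apply: hn_phase_lt; rewrite ln.
have X'0 B : P (hn_phase h' n') B ->
    hom_zero (hn_obj h' n') B /\ hom_zero (shift T (hn_obj h' n')) B.
  move=> PB; apply: HN_hom_zero PB (ltnW n'_lt) => l ln.
  by apply: hn_phase_lt; rewrite ln.
have [|||||XX' AA'] := triangle_iso (hn_tri n_lt) (hn_tri n'_lt).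
- by apply: (X0 _ _).1; rewrite eq_last.
- by apply: (X'0 _ _).1; rewrite -eq_last.
- exact: (X0 _ PA).2.
- exact: (X'0 _ PA').2.
- by rewrite -len -len' !hn_objE.
have [/= nn' facs] :=
  IH _ _ (HN_truncate (ltnW n_lt)) (HN_truncate (ltnW n'_lt)) erefl XX'.
split=> [|i]; first by rewrite len nn'.
rewrite len ltnS leq_eqVlt => /predU1P[->|/facs//].
(* Only the indices into [h'] become [n'], so that [eq_last] and [AA'] apply. *)
by rewrite {2 4}nn'.
Qed.

End HarderNarasimhan.

(** * The action of R x R and its effect on phases, mass and [dB] *)

Section PhaseShift.
Context {R : realType} {k : fieldType} {T : triCat k}.

Definition HN_phase_shift (P : R -> T -> Prop) (a : R) E (h : HN P E) :
  HN (fun phi => P (phi - a)) E.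
Proof.
exists (hn_len h) (hn_obj h) (hn_fac h) (fun i => hn_phase h i + a).
- exact: hn_obj0.
- exact: hn_objE.
- exact: hn_tri.
- by move=> i ih; rewrite addrK; exact: hn_facP.
- by move=> i i' ii'; rewrite ltrD2r; exact: hn_phase_lt.
Defined.

End PhaseShift.

Lemma additive_ext (U W : nmodType) (f g : {additive U -> W}) : f =1 g -> f = g.
Proof.
case: f g => [f fP] [g gP] /= /funext fg; case: _ / fg in gP *.
by case: fP gP => [[f1]] [[g1]]; rewrite (Prop_irrelevance f1 g1).
Qed.

Section Action.
Context {R : realType} {k : fieldType} {T : triCat k} {L : zmodType}.
Context {v : {additive K0 T -> L}} {V : normedModType R} {j : {additive L -> V}}.
Implicit Types s t : stability v j.

Lemma stability_ext s t : st_Z s =1 st_Z t -> st_P s = st_P t -> s = t.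
Proof.
case: s t => [Z P s1 s2 s3 s4 s5 s6] [Z' P' t1 t2 t3 t4 t5 t6] /= /additive_ext ZZ' PP'.
case: _ / ZZ' in t2 t6 *; case: _ / PP' in t1 t2 t3 t4 t5 t6 *.
by congr Stability; exact: Prop_irrelevance.
Qed.

Lemma st_P_shift s phi E : st_P s phi E -> st_P s (phi + 1) (shift T E).
Proof. by move=> PE; apply/st_shift; exists E => //; exact: isomorphic_refl. Qed.

Lemma st_HN_unique s E (h h' : HN (st_P s) E) :
  hn_len h = hn_len h' /\ (forall i, (i < hn_len h)%N ->
    hn_phase h i = hn_phase h' i /\ isomorphic (hn_fac h i) (hn_fac h' i)).
Proof.
apply: HN_unique (isomorphic_refl E); [exact: st_hom|exact: st_P_shift].
Qed.

Lemma hn_len_gt0 (P : R -> T -> Prop) E (h : HN P E) :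
  ~ is_zero E -> (0 < hn_len h)%N.
Proof.
move=> E0; rewrite lt0n; apply/eqP => h0; apply: E0.
by rewrite -(hn_objE h) h0; exact: hn_obj0.
Qed.

(** Uniqueness of the filtration makes the choice by [xget] immaterial. For zero [E] the filtration
    may be empty, and its phase at 0 arbitrary. *)
Lemma phi_plusE s E (h : HN (st_P s) E) : ~ is_zero E ->
  phi_plus s E = hn_phase h 0.
Proof.
move=> E0.
have [h' _ <-] : [set hn_phase h 0 | h in [set: HN (st_P s) E]] (phi_plus s E).
  by apply: xgetPex; eexists; exists h.
by have [_ /(_ _ (hn_len_gt0 _ E0))[]] := st_HN_unique h' h.
Qed.

Lemma phi_minusE s E (h : HN (st_P s) E) : ~ is_zero E ->
  phi_minus s E = hn_phase h (hn_len h).-1.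
Proof.
move=> E0.
have [h' _ <-] : [set hn_phase h (hn_len h).-1 | h in [set: HN (st_P s) E]]
    (phi_minus s E).
  by apply: xgetPex; eexists; exists h.
have [<- /(_ (hn_len h').-1)[]//] := st_HN_unique h' h.
by rewrite ltn_predL hn_len_gt0.
Qed.

Lemma massE s E (h : HN (st_P s) E) :
  mass s E =
    \sum_(i < hn_len h) Normc.normc (st_Z s (v (K0_class (hn_fac h i)))).
Proof.
have [h' _ <-] : [set \sum_(i < hn_len h)
      Normc.normc (st_Z s (v (K0_class (hn_fac h i))))
    | h in [set: HN (st_P s) E]] (mass s E).
  by apply: xgetPex; eexists; exists h.
have [len facs] := st_HN_unique h' h.
(* Sums over ranges of naturals allow the two lengths to be identified by rewriting. *)
rewrite -!(big_mkord xpredT (fun i =>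
  Normc.normc (st_Z s (v (K0_class (hn_fac _ i)))))) -len.
by apply: eq_big_nat => i /andP[_ /facs[_ /K0_class_iso ->]].
Qed.

(** The complex number exp(i pi x), in the shape used by [st_phase]. *)
Definition rot (x : R) : R[i] := (cos (pi * x) +i* sin (pi * x))%C.

Lemma rotD x y : rot (x + y) = rot x * rot y.
Proof.
rewrite /rot mulrDr cosD sinD; apply/eqP; rewrite eq_complex /=.
by rewrite [_ * sin _ + _]addrC !eqxx.
Qed.

Lemma normc_rot x : Normc.normc (rot x) = 1.
Proof. by rewrite /= cos2Dsin2 sqrtr1. Qed.

Lemma normc_real (x : R) : 0 <= x -> Normc.normc x%:C%C = x.
Proof. by move=> x0; rewrite /= expr0n addr0 sqrtr_sqr ger0_norm. Qed.

Definition twist (p : R * R) : R[i] := (expR p.2)%:C%C * rot p.1.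

Lemma normc_twist p : Normc.normc (twist p) = expR p.2.
Proof. by rewrite Normc.normcM normc_rot mulr1 normc_real ?expR_ge0. Qed.

Definition act s (p : R * R) : stability v j.
Proof.
exists (twist p \*o st_Z s) (fun phi => st_P s (phi - p.1)).
- by move=> phi; exact: st_additive.
- move=> phi E PE E0; have [m m0 ZE] := st_phase PE E0.
  (* The modulus is scaled by [expR p.2], and [rot p.1] turns the old phase [phi - p.1] into
     [phi]. *)
  exists (expR p.2 * m); first by rewrite mulr_gt0 ?expR_gt0.
  by rewrite /= ZE -!/(rot _) /twist mulrACA -rotD addrC subrK rmorphM.
- by move=> phi E; rewrite addrAC; exact: st_shift.
- by move=> phi1 phi2 E1 E2 lt; apply: st_hom; rewrite ltrD2r.
- by move=> E /(st_HN s)[h]; constructor; exact: HN_phase_shift.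
(* Central charges are scaled by [expR p.2] in modulus, so the support constant is divided by it. *)
- have [C C0 supp] := st_support s; exists (C / expR p.2).
    by rewrite divr_gt0 ?expR_gt0.
  move=> phi E PE E0; rewrite /= Normc.normcM normc_twist mulrA.
  by rewrite divfK ?gt_eqF ?expR_gt0//; exact: supp PE E0.
Defined.

Lemma act0 s : act s 0 = s.
Proof.
apply: stability_ext => [x|] /=.
  rewrite /twist /= expR0 /rot mulr0 cos0 sin0 mul1r.
  exact: mul1r.
by apply/funext => phi; rewrite subr0.
Qed.

Lemma phi_plus_act s p E : ~ is_zero E ->
  phi_plus (act s p) E = phi_plus s E + p.1.
Proof.
move=> E0; have [h] := st_HN s E0.
by rewrite (phi_plusE h)// (phi_plusE (HN_phase_shift p.1 h : HN (st_P (act s p)) E)).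
Qed.

Lemma phi_minus_act s p E : ~ is_zero E ->
  phi_minus (act s p) E = phi_minus s E + p.1.
Proof.
move=> E0; have [h] := st_HN s E0.
by rewrite (phi_minusE h)// (phi_minusE (HN_phase_shift p.1 h : HN (st_P (act s p)) E)).
Qed.

Lemma mass_act s p E : ~ is_zero E ->
  mass (act s p) E = expR p.2 * mass s E.
Proof.
move=> E0; have [h] := st_HN s E0.
rewrite (massE h) (massE (HN_phase_shift p.1 h : HN (st_P (act s p)) E)).
rewrite mulr_sumr; apply: eq_bigr => i _ /=.
by rewrite Normc.normcM normc_twist.
Qed.

(** Every nonzero object contributes the same numbers, the absolute coordinate differences of [p]
    and [q], so the supremum is their maximum; one nonzero object keeps the set from being empty. *)
Lemma dB_act s p q : (exists E : T, ~ is_zero E) ->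
  dB (act s p) (act s q) = `|p - q|%:E.
Proof.
move=> [E0 E0P].
have massV E : ~ is_zero E ->
    ln (mass (act s p) E / mass (act s q) E) = p.2 - q.2.
  move=> EP; rewrite !mass_act// -mulf_div divff ?mulr1 ?gt_eqF ?mass_gt0//.
  by rewrite -expRB expRK.
have shiftB (x y z : R) : x + y - (x + z) = y - z by rewrite opprD addrACA subrr add0r.
apply/eqP; rewrite eq_le; apply/andP; split.
  apply: ge_ereal_sup => x [E EP]; rewrite !phi_plus_act// !phi_minus_act// massV//.
  rewrite !shiftB prod_normE.
  by case=> ->; rewrite lee_fin le_max lexx ?orbT.
(* Whichever difference is larger, [E0] attains it: the second through the mass, the first through
   [phi_plus]. *)
rewrite prod_normE; case: (leP `|(p - q).1| `|(p - q).2|) => _;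
  apply: ereal_sup_ubound; exists E0 => //.
  by apply: Or33; rewrite massV.
by apply: Or31; rewrite !phi_plus_act// shiftB.
Qed.

End Action.

(** * Geodesics and triangles in an isometric copy of the sup-norm plane *)

Section SupNormPlane.
Context {R : realType} {X : topologicalType}.
Variables (d : X -> X -> \bar R) (A : set X) (f : R * R -> X).
Hypothesis f_cont : continuous f.
Hypothesis f_isom : forall p q, d (f p) (f q) = `|p - q|%:E.
Hypothesis f_sub : forall p, A (f p).

Definition segment (p q : R * R) (t : R) : R * R := p + t *: (q - p).

Lemma segment_continuous p q : continuous (segment p q).
Proof.
move=> t; apply: cvgD; first exact: cvg_cst.
by apply: cvgZr_tmp; exact: cvg_id.
Qed.

Lemma segment_geodesic p q : is_geodesic d A (f p) (f q) (f \o segment p q).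
Proof.
split=> /=.
- apply: continuous_subspaceT => t; apply: continuous_comp; last exact: f_cont.
  exact: segment_continuous.
- by rewrite /segment scale0r addr0.
- by rewrite /segment scale1r addrC subrK.
- by move=> t _; exact: f_sub.
- move=> t t' _ _; rewrite !f_isom -EFinM /segment opprD addrACA subrr add0r.
  by rewrite -scalerBl normrZ distrC mulrC [`|p - q|]distrC.
Qed.

(** The vertices are (0, 0), (1, 1), (2, 0): vertex 1 is the apex and side 2 the base. *)
Definition apex_triangle (i : 'I_3) : R * R := (i%:R, (i == 1)%:R).

Lemma apex_triangleP (N : R) :
  is_geodesic_triangle d A (fun i => f (N *: apex_triangle i))
    (fun i => f \o segment (N *: apex_triangle i) (N *: apex_triangle (i + 1))).
Proof. by move=> i; split; [exact: f_sub|exact: segment_geodesic]. Qed.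

Let half_in : (2^-1 : R) \in `[0, 1].
Proof. by rewrite in_itv /=; lra. Qed.

Let scaleRE (a b : R) : a *: b = a * b. Proof. by []. Qed.

Fact mod3E : ((1 %% 3)%N = 1%N) * (((0 + 1) %% 3)%N = 1%N) *
  (((1 + 1) %% 3)%N = 2%N) * (((2 + 1) %% 3)%N = 0%N).
Proof. by []. Qed.

Lemma sup_norm_plane_not_CAT0 : ~ CAT0 d A.
Proof.
move=> [_ cat0].
(* The sup-norm sides are 1, 1, 2, so the comparison vertices are collinear: (0, 0), (1, 0), (2,
   0). *)
pose c (i : 'I_3) : 'rV[R]_2 := \row_(l < 2) (i%:R * (l == 0)%:R).
have compc : is_comparison_triangle d (fun i => f (1 *: apex_triangle i)) c.
  move=> i; rewrite f_isom !scale1r prod_normE /euclid; congr (_%:E).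
  rewrite !big_ord_recl big_ord0 !mxE /= !mulr1 !mulr0 subrr expr0n /= !addr0.
  rewrite sqrtr_sqr; apply/esym/max_idPl; move: i => [[|[|[|//]]] hi] /=.
  - exact: lexx.
  - by rewrite !mod3E subr0 distrC -natrB.
  - by rewrite subr0 normr0.
(* Midpoint of the base against the apex, the start of side 1: both comparison points are (1, 0),
   yet the second coordinates in the plane differ by 1. *)
have /(_ 2 1 2^-1 0 half_in) := cat0 _ _ _ (apex_triangleP 1) compc.
rewrite in_itv /= lexx ler01 => /(_ isT).
rewrite f_isom prod_normE /euclid !big_ord_recl big_ord0 !mxE /= !mod3E.
rewrite !mulr0 !mulr1 !addr0 !subrr expr0n /= addr0 sqrtr_sqr lee_fin ge_max.
rewrite !scaleRE => /andP[_]; rewrite [X in _ <= `|X|](_ : _ = 0); last by lra.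
rewrite normr0 normr_le0 => /eqP; lra.
Qed.

Lemma sup_norm_plane_not_hyperbolic : ~ Gromov_hyperbolic d A.
Proof.
move=> [delta delta0 [_ thin]].
(* At scale [2 * delta], the coordinates of a point on an upper side differ from those of the base
   midpoint by [2 * delta * t] and [2 * delta * (1 - t)], in some order. These add up to
   [2 * delta], so both cannot be below [delta]. *)
have [i [t [i2]]] := thin _ _ (apex_triangleP (2 * delta)) 2 2^-1 half_in.
rewrite in_itv /= => /andP[t0 t1]; rewrite f_isom lte_fin.
rewrite prod_normE gt_max !ltr_norml.
move: i i2 => [[|[|[|//]]] hi] /= i2; rewrite !mod3E !scaleRE.
- by move=> /andP[/andP[? ?] /andP[? ?]]; nra.
- by move=> /andP[/andP[? ?] /andP[? ?]]; nra.
- by [].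
Qed.

End SupNormPlane.

(** * Orbits inside a connected component *)

Section Orbit.
Context {R : realType} {k : fieldType} {T : triCat k} {L : zmodType}.
Context {v : {additive K0 T -> L}} {V : normedModType R} {j : {additive L -> V}}.
Hypothesis T_neq0 : exists E : T, ~ is_zero E.

Lemma act_continuous (s : stability v j) : continuous (act s).
Proof.
move=> p; apply/cvg_ballP => e e0; near=> q.
change (dB (act s p) (act s q) < e%:E)%E.
rewrite dB_act// lte_fin; near: q.
exact: cvgr_dist_lt.
Unshelve. all: by end_near.
Qed.

(** The segment from 0 to [p] maps to a connected set that joins [s], which is [act s 0], to
    [act s p]. *)
Lemma act_connected (s : stability v j) p :
  connected_component [set: stability v j] s (act s p).
Proof.
exists ((act s \o segment 0 p) @` `[0, 1]); last first.
  by exists 1; rewrite /= ?in_itv /= ?ler01 ?lexx// /segment scale1r subr0 add0r.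
split=> //.
  by exists 0; rewrite /= ?in_itv /= ?ler01 ?lexx// /segment scale0r addr0 act0.
apply: connected_continuous_connected; first exact: segment_connected.
apply: continuous_subspaceT => t; apply: continuous_comp.
  exact: segment_continuous.
exact: act_continuous.
Qed.

End Orbit.

Theorem theorem3p4 (R : realType) (k : fieldType) (T : triCat k)
  (L : zmodType) (n : nat) (e : 'I_n -> L)
  (V : normedModType R) (j : {additive L -> V})
  (v : {additive K0 T -> L}) (alpha : UMagmaMorphism.type (Aut T) (zaut L))
  (S : set (stability v j)) :
  finite_type T ->
  (exists E : T, ~ is_zero E) ->
  is_Zbasis e -> is_Rbasis (j \o e) ->
  (forall x : L, exists a : K0 T, v a = x) ->
  (forall (F : autoeq T) (a : K0 T),
     v (K0_map F a) = alpha (\pi_(Aut T) F) (v a)) ->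
  [set: stability v j] !=set0 ->
  (exists s : stability v j,
     S = connected_component [set: stability v j] s) ->
  ~ CAT0 (@dB _ _ _ _ v _ j) S /\ ~ Gromov_hyperbolic (@dB _ _ _ _ v _ j) S.
Proof.
move=> _ T_neq0 _ _ _ _ _ [s ->].
(* The component of [s] contains the whole orbit of [s], so the bad triangles of the plane lie in
   it. *)
have act_S p := act_connected T_neq0 s p.
have act_c : continuous (act s) by exact: act_continuous.
have act_d p q := dB_act s p q T_neq0.
split; [exact: sup_norm_plane_not_CAT0 act_c act_d act_S|].
exact: sup_norm_plane_not_hyperbolic act_c act_d act_S.
Qed.
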